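(* Let $(X,d,\mu)$ be a connected $Q$-doubling space with $Q>1$, and let $C_d$ be its doubling constant. (i) Suppose there exist constants $C_1,C_2>0$ such that for all $u\in M^{1,Q}(X)$ (with $\|u\|_{M^{1,Q}(X)}\neq 0$) and for all balls $B\subset X$, $$\frac{1}{\mu(B)}\int_{B}\exp\left(C_1\frac{|u-u_B|}{\|u\|_{M^{1,Q}(X)}}\right)d\mu\leq C_2 .$$ Then there exists $b=b(C_1,C_2,C_d)>0$ such that $\mu(B(x,r))\geq br^Q$ holds for all $x\in X$ and for all $0<r<\min\{1,(\operatorname{diam}X)/2\}$. (ii) Let $p>Q$ and suppose there exists a constant $C_3>0$ such that for all $u\in M^{1,p}(X)$ and for every $y,z\in X$, $$|u(y)-u(z)|\leq C_3\|u\|_{M^{1,p}(X)}\,d(y,z)^{1-Q/p}.$$ Then there exists $b=b(C_3,C_d)>0$ such that $\mu(B(x,r))\geq br^Q$ holds for all $x\in X$ and for all $0<r<\min\{1,(\operatorname{diam}X)/2\}$.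
   Context: A metric measure space $(X,d,\mu)$ is a metric space $(X,d)$ with a Borel regular measure $\mu$ such that every nonempty open set has positive measure and every bounded set has finite measure. The measure $\mu$ is doubling with constant $C_d\ge1$ if $\mu(B(x,2r))\le C_d\,\mu(B(x,r))$ for all $x\in X$, $r>0$. The space is $Q$-doubling if $\mu$ is doubling and there is a constant $C\ge 1$ such that $$\left(\frac{s}{r}\right)^Q\le C\,\frac{\mu(B(x,s))}{\mu(B(a,r))}$$ whenever $a\in X$, $x\in B(a,r)$ and $0<s\le r$. The exponents $Q$ and $p$ are regarded as fixed in the notation $b=b(C_1,C_2,C_d)$ and $b=b(C_3,C_d)$. For a ball $B$, $u_B=\frac1{\mu(B)}\int_B u\,d\mu$. $\operatorname{diam}X\in[0,\infty]$ is the diameter of $X$. Hajłasz–Sobolev space: let $S\subset X$ be measurable, $0<s<\infty$, $0<p\le\infty$. A nonnegative measurable function $g$ is an $s$-gradient of a measurable function $u$ in $S$ if there is a set $E\subset S$ with $\mu(E)=0$ such that $|u(x)-u(y)|\le d(x,y)^s(g(x)+g(y))$ for all $x,y\in S\setminus E$. Let $\mathcal D^s(u)$ be the collection of all $s$-gradients of $u$, and $\|u\|_{\dot M^{s,p}(S)}=\inf_{g\in\mathcal D^s(u)}\|g\|_{L^p(S)}$. The homogeneous space $\dot M^{s,p}(S)$ consists of the measurable $u$ for which this is finite, and $M^{s,p}(S)=\dot M^{s,p}(S)\cap L^p(S)$ with norm $\|u\|_{M^{s,p}(S)}=\|u\|_{L^p(S)}+\|u\|_{\dot M^{s,p}(S)}$.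 Here $s=1$ and $S=X$. Functions that agree almost everywhere are identified, and the pointwise inequality in (ii) is understood for a suitable (continuous) representative of $u$. *)

(* Defs.v *)
From HB Require Import structures.
From mathcomp Require Import all_boot all_order all_algebra.
From mathcomp Require Import all_classical all_reals all_analysis.

Set Implicit Arguments.
Unset Strict Implicit.
Unset Printing Implicit Defensive.

Import Order.TTheory GRing.Theory Num.Theory.
Import numFieldNormedType.Exports.

Local Open Scope classical_set_scope.
Local Open Scope ring_scope.

(* The library's measurable types are pointed, so metric spaces that carry a
   measure have to be nonempty. *)
#[short(type="pointedMetricType")]
HB.structure Definition PointedMetric (K : numDomainType) :=
  { M of Metric K M & Pointed M }.

Section metric_measure_space.
Context {R : realType} {X : pointedMetricType R}.

Definition borel_set : set (set X) := <<s [set U : set X | open U] >>.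

Definition metric_bounded (A : set X) :=
  exists M : R, forall x y, A x -> A y -> mdist x y <= M.

Definition diam : \bar R :=
  ereal_sup [set (mdist z.1 z.2)%:E | z in [set: X * X]].

(* As is customary in analysis on metric spaces, a Borel regular measure is an
   outer measure, defined on all subsets of X.  Its measurable sets are the
   Caratheodory measurable ones; on [caratheodory_type mu], a copy of X, it is
   a (complete) measure, and this is where functions are integrated. *)
Variable mu : {outer_measure set X -> \bar R}.

Definition borel_regular :=
  (forall A, borel_set A -> mu.-caratheodory A) /\
  (forall A, exists B, [/\ borel_set B, A `<=` B & mu B = mu A]).

Definition metric_measure_space :=
  [/\ borel_regular,
      forall U : set X, open U -> U !=set0 -> (0 < mu U)%E &
      forall A : set X, metric_bounded A -> (mu A < +oo)%E].

Definition doubling (Cd : R) :=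
  1 <= Cd /\
  forall (x : X) (r : R), 0 < r ->
    (mu (ball x (2 * r)) <= Cd%:E * mu (ball x r))%E.

(* [Cd] is the doubling constant of mu; it is unrelated to the constant [C] of
   the relative lower volume bound. *)
Definition Q_doubling (Q Cd : R) :=
  doubling Cd /\
  exists C : R, 1 <= C /\
    forall (a x : X) (r s : R), ball a r x -> 0 < s -> s <= r ->
      (s / r) `^ Q <= C * (fine (mu (ball x s)) / fine (mu (ball a r))).

Local Notation T := (caratheodory_type mu).
Local Notation m := (mu : {measure set T -> \bar R}).

Definition Lpnorm (p : \bar R) (u : X -> R) : \bar R :=
  Lnorm m p (fun x : T => (u x)%:E).

Definition mu_measurable_fun (u : X -> R) :=
  measurable_fun [set: T] (u : T -> R).

Definition ae_equal (u v : X -> R) := mu [set x | u x <> v x] = 0%E.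

Definition mean (u : X -> R) (B : set X) : R :=
  (fine (mu B))^-1 * (\int[m]_(x in B) u x)%R.

(* The average of a nonnegative function, +oo if it is not integrable on B. *)
Definition emean (f : X -> R) (B : set X) : \bar R :=
  ((fine (mu B))^-1%:E * \int[m]_(x in B) (f x)%:E)%E.

Definition s_gradient (s : R) (u : X -> R) : set (X -> R) :=
  [set g | [/\ mu_measurable_fun g, (forall x, 0 <= g x) &
    exists E : set X, mu E = 0%E /\
      forall x y, ~ E x -> ~ E y ->
        `|u x - u y| <= mdist x y `^ s * (g x + g y)]].

Definition dotM_norm (s : R) (p : \bar R) (u : X -> R) : \bar R :=
  ereal_inf [set Lpnorm p g | g in s_gradient s u].

Definition M_norm (s : R) (p : \bar R) (u : X -> R) : \bar R :=
  (Lpnorm p u + dotM_norm s p u)%E.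

Definition M_space (s : R) (p : \bar R) : set (X -> R) :=
  [set u | [/\ mu_measurable_fun u, (Lpnorm p u < +oo)%E &
               (dotM_norm s p u < +oo)%E]].

End metric_measure_space.

Arguments diam {R} X.

(* Main.v *)
Require Import Defs.
From HB Require Import structures.
From mathcomp Require Import all_boot all_order all_algebra.
From mathcomp Require Import all_classical all_reals all_analysis.
From mathcomp Require Import measurable_realfun ring lra.

Set Implicit Arguments.
Unset Strict Implicit.
Unset Printing Implicit Defensive.

Import Order.TTheory GRing.Theory Num.Theory.
Import numFieldNormedType.Exports.

Local Open Scope classical_set_scope.
Local Open Scope ring_scope.

(** Both embeddings are tested on one function, the tent
    u(y) = max(0, 1 - d(x,y)/t), which is 1/t-Lipschitz and vanishes off
    B(x,t), so that 1_B(x,t)/t is a 1-gradient of it.  For t <= 1 this gives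
    ([tent_norm])
      N := ||u||_{M^{1,p}} <= (1 + 1/t) mu(B(x,t))^{1/p}
                           <= (2/t) mu(B(x,t))^{1/p},
    so a lower bound on N is a lower bound on the measure of a ball.

    Since r < diam X / 2, some point lies farther than r from x, and because X
    is connected there are points at every distance s <= r from x
    ([connected_sphere]); hence u drops from 1 to 0 near x.

    Hoelder case: take t = r and d(x,z) = r.  A continuous representative of u
    is u itself, because nonempty open sets have positive measure
    ([continuous_ae_equal]).  Thus 1 = |u(x) - u(z)| <= C3 N r^{1-Q/p}, and
    the bound on N gives mu(B(x,r)) >= (2 C3)^{-p} r^Q.

    Exponential case: take t = r/2 and d(x,z) = 3r/4.  Then u >= 1/2 on
    B(x,r/4) and u = 0 on B(z,r/4), so whatever the mean c of u is,
    |u - c| >= 1/4 on one of these two balls.  By doubling that ball fills at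
    least the proportion Cd^{-3} of B(x,r), so exp(C1/(4N)) <= C2 Cd^3; with
    1 + a <= exp a this becomes C1 <= 4 C2 Cd^3 N
    ([exp_oscillation_tent_le]), and the bound on N concludes. *)

(** * Lipschitz functions and spheres in a metric space *)

Section metric_space.
Context {R : realType} {X : metricType R}.

Lemma lipschitz_continuous (k : R) (f : X -> R) :
  (forall y z, `|f y - f z| <= k * mdist y z) -> continuous f.
Proof.
move=> fk y; apply/cvgrPdist_lt => e e0.
have k0 : 0 < `|k| + 1 by rewrite ltr_wpDl.
near=> z.
have : mdist y z < e / (`|k| + 1).
  near: z; have := @nbhsx_ballx _ X y (e / (`|k| + 1)).
  by rewrite ballEmdist; apply; rewrite divr_gt0.
rewrite ltr_pdivlMr//; apply: le_lt_trans; apply: (le_trans (fk _ _)).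
rewrite mulrC ler_wpM2l ?mdist_ge0//.
by rewrite (le_trans (ler_norm k))// lerDl.
Unshelve. all: by end_near. Qed.

Lemma mdist_lipschitz (x y z : X) : `|mdist x y - mdist x z| <= mdist y z.
Proof.
have := metric_triangle x z y; have := metric_triangle x y z.
rewrite (metric_sym z y) ler_norml => h1 h2; apply/andP; split; lra.
Qed.

Lemma continuous_mdist (x : X) : continuous (mdist x).
Proof.
by apply: (@lipschitz_continuous 1) => y z; rewrite mul1r mdist_lipschitz.
Qed.

Lemma open_ball (x : X) (r : R) : open (ball x r).
Proof.
rewrite ballEmdist (_ : [set _ | _] = mdist x @^-1` `]-oo, r[); last first.
  by apply/seteqP; split => y /=; rewrite in_itv.
by move/continuousP: (@continuous_mdist x); apply; exact: interval_open.
Qed.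

(** The image of a connected space under the distance to x is an interval
    containing 0. *)
Lemma connected_sphere (x w : X) (s : R) :
  connected [set: X] -> 0 <= s -> s <= mdist x w -> exists z, mdist x z = s.
Proof.
move=> cX s0 sw.
have : connected (mdist x @` [set: X]).
  apply: connected_continuous_connected => //.
  by apply: continuous_subspaceT; exact: continuous_mdist.
move=> /connected_intervalP /(_ 0 (mdist x w)) h.
have [||//|z _ zs] := h _ _ s; last by exists z.
- by exists x => //; rewrite mdistxx.
- by exists w.
- by rewrite s0.
Qed.

(** * The tent function *)

Definition tent (x : X) (t : R) (y : X) : R := Num.max 0 (1 - mdist x y / t).

Lemma tent_ge0 x t y : 0 <= tent x t y.
Proof. by rewrite le_max lexx. Qed.

Lemma tent_le1 x t y : 0 <= t -> tent x t y <= 1.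
Proof. by move=> t0; rewrite ge_max ler01 gerBl divr_ge0// mdist_ge0. Qed.

Lemma tent_center x t : tent x t x = 1.
Proof. by rewrite /tent mdistxx mul0r subr0 max_r. Qed.

Lemma tent_out x t y : 0 < t -> t <= mdist x y -> tent x t y = 0.
Proof. by move=> t0 h; rewrite /tent max_l// subr_le0 ler_pdivlMr// mul1r. Qed.

Lemma tent_half x t y : 0 < t -> mdist x y <= t / 2 -> 2^-1 <= tent x t y.
Proof.
move=> t0 h; rewrite le_max; apply/orP; right.
have : mdist x y / t <= 2^-1 by rewrite ler_pdivrMr//; lra.
lra.
Qed.

Lemma tent_lipschitz x t y z : 0 < t ->
  `|tent x t y - tent x t z| <= t^-1 * mdist y z.
Proof.
move=> t0.
have : `|mdist x y / t - mdist x z / t| <= t^-1 * mdist y z.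
  rewrite -mulrBl normrM (gtr0_norm (_ : 0 < t^-1)) ?invr_gt0// mulrC.
  by rewrite ler_wpM2l ?invr_ge0 ?(ltW t0)// mdist_lipschitz.
rewrite /tent !ler_norml => /andP[h1 h2].
case: (leP 0 (1 - mdist x y / t)) => ?;
  case: (leP 0 (1 - mdist x z / t)) => ?; by apply/andP; split; lra.
Qed.

Lemma continuous_tent x t : 0 < t -> continuous (tent x t).
Proof.
by move=> t0; apply: (@lipschitz_continuous t^-1) => y z; exact: tent_lipschitz.
Qed.

End metric_space.

(** * Measure and Sobolev norm of the tent *)

Section metric_measure.
Context {R : realType} {X : pointedMetricType R}.

(** Of two points more than 2r apart, one is more than r away from x. *)
Lemma exists_far (x : X) (r : R) :
  (r%:E < diam X * (2^-1)%:E)%E -> exists w, r < mdist x w.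
Proof.
rewrite -lte_pdivrMr// => /ereal_sup_gt[_ [[y z] _ <-]]/=.
rewrite lte_fin => h.
have := metric_triangle y x z; rewrite (metric_sym y x) => h2.
have [|?] := ltP r (mdist x y); first by exists y.
by exists z; lra.
Qed.

Context (mu : {outer_measure set X -> \bar R}).
Context (mmu : metric_measure_space mu).
Local Notation T := (caratheodory_type mu).
Local Notation m := (mu : {measure set T -> \bar R}).

Lemma open_caratheodory (U : set X) : open U -> measurable (U : set T).
Proof.
move=> oU; case: mmu => -[+ _] _ _; apply.
exact: sub_sigma_algebra.
Qed.

Lemma continuous_mu_measurable (f : X -> R) :
  continuous f -> mu_measurable_fun mu f.
Proof.
move=> /continuousP cf; apply: (measurability _ (RGenOpens.measurableE R)).
move=> _ [_ [a [b ->] <-]]; rewrite setTI.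
by apply: open_caratheodory; apply: cf; exact: interval_open.
Qed.

(** The set where u and v differ is open and null, hence empty. *)
Lemma continuous_ae_equal (u v : X -> R) : continuous u -> continuous v ->
  ae_equal mu u v -> u = v.
Proof.
move=> cu cv uv; apply/funext => x; apply: contrapT => /eqP uvx.
case: mmu => _ /(_ [set x | u x <> v x]) h _.
have : (0 < mu [set x | u x <> v x])%E.
  apply: h; last by exists x; exact/eqP.
  rewrite (_ : [set _ | _] = (u \- v) @^-1` [set~ 0]); last first.
    apply/seteqP; split => y /=; first by move=> ne /subr0_eq.
    by move=> ne uvy; apply: ne; rewrite uvy subrr.
  have /continuousP : continuous (u \- v).
    by move=> y; apply: continuousB; [exact: cu|exact: cv].
  apply; rewrite openC; exact: closed_eq.
by rewrite uv ltxx.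
Qed.

Lemma mu_ball_gt0 x r : 0 < r -> (0 < mu (ball x r))%E.
Proof.
move=> r0; case: mmu => _ + _; apply; first exact: open_ball.
by exists x; exact: ballxx.
Qed.

Lemma mu_ball_fin x r : mu (ball x r) \is a fin_num.
Proof.
rewrite ge0_fin_numE; last exact: outer_measure_ge0.
case: mmu => _ _; apply; exists (r + r) => y z.
rewrite ballEmdist /= => xy xz; have := metric_triangle y x z.
rewrite (metric_sym y x); lra.
Qed.

Lemma Lpnorm_le (p c : R) (u : X -> R) (x : X) (r : R) :
  0 < p -> 0 <= c -> mu_measurable_fun mu u ->
  (forall y, `|u y| <= c * \1_(ball x r) y) ->
  (Lpnorm mu p%:E u <= (c * fine (mu (ball x r)) `^ p^-1)%:E)%E.
Proof.
move=> p0 c0 mf uc; rewrite /Lpnorm Lnorm.unlock.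
have mB : measurable (ball x r : set T).
  by apply: open_caratheodory; exact: open_ball.
have le : (\int[m]_y (`|(u y)%:E| `^ p) <= (c `^ p)%:E * mu (ball x r))%E.
  have -> : mu (ball x r) = (\int[m]_y (\1_(ball x r : set T) y)%:E)%E.
    by rewrite integral_indic// setIT.
  rewrite -ge0_integralZl//; last 2 first.
  - by apply/measurable_EFinP; exact: measurable_indic.
  - by rewrite lee_fin powR_ge0.
  apply: ge0_le_integral => //.
  - by move=> y _; rewrite poweR_ge0.
  - apply: (measurableT_comp (measurable_poweR _)).
    by apply: measurableT_comp => //; exact/measurable_EFinP.
  - apply/measurable_EFinP; exact: measurable_funM.
  - move=> y _ /=; rewrite lee_fin.
    have := uc y; rewrite indicE; case: (y \in _); rewrite ?mulr1 ?mulr0 => uy.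
      by rewrite ge0_ler_powR ?nnegrE// ltW.
    have -> : `|u y| = 0 by apply/eqP; rewrite eq_le uy normr_ge0.
    by rewrite powR0// gt_eqF.
apply: (@le_trans _ _ (((c `^ p)%:E * mu (ball x r)) `^ p^-1)%E).
  apply: gt0_ler_poweR; rewrite ?invr_ge0 ?(ltW p0)// in_itv/= leey andbT.
    by apply: integral_ge0 => y _; rewrite lee_fin powR_ge0.
  by rewrite mule_ge0// ?lee_fin ?powR_ge0// outer_measure_ge0.
rewrite -(fineK (mu_ball_fin x r)) -EFinM poweR_EFin lee_fin.
rewrite powRM ?powR_ge0 ?fine_ge0 ?outer_measure_ge0//.
by rewrite -powRrM mulfV ?gt_eqF// powRr1.
Qed.

Lemma tent_s_gradient (x : X) (t : R) : 0 < t ->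
  s_gradient mu 1 (tent x t) (fun y => t^-1 * \1_(ball x t) y).
Proof.
move=> t0; have mB : measurable (ball x t : set T).
  by apply: open_caratheodory; exact: open_ball.
split.
- exact: measurable_funM.
- by move=> y; rewrite mulr_ge0// invr_ge0 ltW.
exists set0; split; first exact: outer_measure0.
move=> y z _ _; rewrite powRr1 ?mdist_ge0// -mulrDr mulrA (mulrC _ t^-1).
have out w : w \notin (ball x t : set X) -> tent x t w = 0.
  rewrite notin_setE ballEmdist /= => /negP; rewrite -leNgt; exact: tent_out.
have le1 (k : R) : 1 <= k ->
    `|tent x t y - tent x t z| <= t^-1 * mdist y z * k.
  move=> k1; rewrite (le_trans (tent_lipschitz x y z t0))// ler_peMr//.
  by rewrite mulr_ge0 ?mdist_ge0// invr_ge0 ltW.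
rewrite !indicE; have [yB|yB] := boolP (y \in _).
  by apply: le1; rewrite lerDl.
have [zB|zB] := boolP (z \in _); first by apply: le1; rewrite lerDr.
by rewrite !out// subrr normr0 addr0 mulr0.
Qed.

(** The norm does not vanish because a continuous function of zero Lebesgue
    norm is identically 0, while the tent takes the value 1 at x.  The factor
    2/t bounds 1 + 1/t, the contributions of the tent and of its gradient. *)
Lemma tent_norm (p t : R) (x : X) : 0 < p -> 0 < t -> t <= 1 ->
  [/\ M_space mu 1 p%:E (tent x t), M_norm mu 1 p%:E (tent x t) != 0%E,
      0 < fine (M_norm mu 1 p%:E (tent x t)) &
      fine (M_norm mu 1 p%:E (tent x t)) <=
        2 / t * fine (mu (ball x t)) `^ p^-1].
Proof.
move=> p0 t0 t1; set u := tent x t; set V := fine _ `^ _.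
have cu : continuous u by exact: continuous_tent.
have mf : mu_measurable_fun mu u by exact: continuous_mu_measurable.
have V0 : 0 <= V by exact: powR_ge0.
have Lu : (Lpnorm mu p%:E u <= V%:E)%E.
  rewrite -[V]mul1r; apply: Lpnorm_le => // y.
  rewrite mul1r ger0_norm ?tent_ge0//.
  rewrite indicE; have [yB|] := boolP (y \in _); first exact/tent_le1/ltW.
  rewrite notin_setE ballEmdist /= => /negP.
  by rewrite -leNgt /u => /tent_out->.
have grad := tent_s_gradient x t0.
have Lg : (dotM_norm mu 1 p%:E u <= (t^-1 * V)%:E)%E.
  apply: (@le_trans _ _ (Lpnorm mu p%:E (fun y => t^-1 * \1_(ball x t) y))).
    by apply: ereal_inf_lbound; exists (fun y => t^-1 * \1_(ball x t) y).
  have [mg g0 _] := grad.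
  apply: Lpnorm_le; rewrite ?invr_ge0 ?(ltW t0)// => y.
  by rewrite ger0_norm// g0.
have Lu0 : (0 <= Lpnorm mu p%:E u)%E by exact: Lnorm_ge0.
have Lg0 : (0 <= dotM_norm mu 1 p%:E u)%E.
  by apply: le_ereal_inf_tmp => _ [g _ <-]; exact: Lnorm_ge0.
have N0 : M_norm mu 1 p%:E u != 0%E.
  apply/eqP => /eqP; rewrite /M_norm padde_eq0// => /andP[/eqP L0 _].
  have [||A [_ A0 uA]] := Lnorm_eq0_eq0 _ _ L0.
  - exact/measurable_EFinP.
  - by rewrite lte_fin.
  have : u = cst 0.
    apply: continuous_ae_equal => //; first by move=> ?; exact: cvg_cst.
    apply/eqP; rewrite eq_le outer_measure_ge0 andbT -A0.
    apply: le_outer_measure => y /= uy; apply: uA => /= /(_ I) [].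
    exact: uy.
  move=> /(congr1 (@^~ x)); rewrite /u tent_center => /eqP.
  by rewrite oner_eq0.
have Nle : (M_norm mu 1 p%:E u <= (2 / t * V)%:E)%E.
  apply: (le_trans (leeD Lu Lg)); rewrite -EFinD lee_fin.
  rewrite -[X in X + _]mul1r -mulrDl ler_wpM2r//.
  have : 1 <= t^-1 by rewrite -[1]invr1 lef_pV2 ?posrE.
  lra.
have NN : (0 <= M_norm mu 1 p%:E u)%E by exact: adde_ge0.
have Nfin : M_norm mu 1 p%:E u \is a fin_num.
  by rewrite ge0_fin_numE// (le_lt_trans Nle)// ltry.
split => //.
- split=> //; first exact: le_lt_trans Lu (ltry _).
  exact: le_lt_trans Lg (ltry _).
- by rewrite fine_gt0// lt_neqAle eq_sym N0 NN -ge0_fin_numE.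
- by rewrite -lee_fin fineK.
Qed.

(** Markov's inequality for averages over B. *)
Lemma emean_ge (f : X -> R) (A B : set X) (k : R) :
  open A -> open B -> A `<=` B -> mu_measurable_fun mu f ->
  (forall y, 0 <= f y) -> 0 <= k -> (forall y, A y -> k <= f y) ->
  ((fine (mu B))^-1%:E * (k%:E * mu A) <= emean mu f B)%E.
Proof.
move=> oA oB AB mf f0 k0 kf; rewrite /emean lee_wpmul2l//.
  by rewrite lee_fin invr_ge0 fine_ge0// outer_measure_ge0.
have mA : measurable (A : set T) by exact: open_caratheodory.
have mB : measurable (B : set T) by exact: open_caratheodory.
have mf' (D : set T) : measurable_fun D (fun y : T => (f y)%:E).
  by apply/measurable_EFinP; exact: measurable_funTS.
rewrite (_ : mu A = m A)// -(integral_cst m mA).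
apply: (@le_trans _ _ (\int[m]_(y in A) (f y)%:E)%E).
  by apply: ge0_le_integral => //.
by apply: ge0_subset_integral => // y _; rewrite lee_fin.
Qed.

Lemma doubling_iter (Cd : R) (x : X) (r : R) (n : nat) :
  doubling mu Cd -> 0 < r ->
  (mu (ball x (2 ^+ n * r)) <= (Cd ^+ n)%:E * mu (ball x r))%E.
Proof.
move=> [Cd1 dbl] r0; elim: n => [|n IH]; first by rewrite !expr0 mul1r mul1e.
rewrite !exprS -mulrA EFinM -muleA.
apply: (le_trans (dbl x _ _)); first by rewrite mulr_gt0// exprn_gt0.
by rewrite lee_wpmul2l// lee_fin (le_trans ler01).
Qed.

(** A function whose average over a ball is at most C cannot exceed C D
    throughout a smaller ball that fills the proportion 1/D of it. *)
Lemma value_le_of_emean_le (f : X -> R) (a x : X) (s r k C D : R) :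
  0 < s -> ball a s `<=` ball x r ->
  (mu (ball x r) <= D%:E * mu (ball a s))%E ->
  mu_measurable_fun mu f -> (forall y, 0 <= f y) -> 0 <= k ->
  (forall y, ball a s y -> k <= f y) ->
  (emean mu f (ball x r) <= C%:E)%E -> k <= C * D.
Proof.
move=> s0 sub dbl mf f0 k0 kf /(le_trans (emean_ge _ _ _ _ _ _ kf)).
move=> /(_ (open_ball a s) (open_ball x r) sub mf f0 k0).
have := mu_ball_gt0 a s0; have := le_outer_measure mu _ _ sub; move: dbl.
rewrite -(fineK (mu_ball_fin a s)) -(fineK (mu_ball_fin x r)).
rewrite -!EFinM !lee_fin lte_fin.
set va := fine (mu (ball a s)); set vx := fine (mu (ball x r)) => dbl le va0 h.
have vx0 : 0 < vx by exact: lt_le_trans le.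
move: h; rewrite mulrC ler_pdivrMr// => h.
have C0 : 0 <= C.
  by rewrite -(pmulr_lge0 _ vx0) (le_trans _ h)// mulr_ge0// ltW.
by rewrite -(ler_pM2r va0) -mulrA (le_trans h)// ler_wpM2l.
Qed.

(** The constant c stands for the mean of the tent.  The tent is at least 1/2
    near x and 0 near a point z at distance 3r/4 from x, and no real c is
    closer than 1/4 to values of both kinds. *)
Lemma exp_oscillation_tent_le (x : X) (r Cd C1 C2 N c : R) :
  connected [set: X] -> doubling mu Cd -> 0 < C1 -> 0 < N -> 0 < r ->
  (exists w, r < mdist x w) ->
  (emean mu (fun y => expR (C1 * (`|tent x (r / 2) y - c| / N)))%R (ball x r)
     <= C2%:E)%E ->
  C1 <= 4 * (C2 * Cd ^+ 3) * N.
Proof.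
move=> cX dbl C10 N0 r0 [w xw] hexp.
have r8 : 2 ^+ 3 * (r / 4) = 2 * r by rewrite !exprS expr0; field.
have r40 : 0 < r / 4 by rewrite divr_gt0.
have [z xz] : exists z, mdist x z = 3 / 4 * r.
  by apply: (connected_sphere (w := w)) => //; lra.
have mf : mu_measurable_fun mu
    (fun y => expR (C1 * (`|tent x (r / 2) y - c| / N))).
  apply: continuous_mu_measurable => y.
  apply: continuous_comp; last exact: continuous_expR.
  apply: continuousM; first exact: cvg_cst.
  apply: continuousM; last exact: cvg_cst.
  apply: (@continuous_comp _ _ _ (fun y => tent x (r / 2) y - c) Num.norm).
    apply: continuousB; last exact: cvg_cst.
    by apply: continuous_tent; rewrite divr_gt0.
  exact: norm_continuous.
suff [a [ax kf]] : exists a, mdist x a <= 3 / 4 * r /\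
    forall y, ball a (r / 4) y -> 4^-1 <= `|tent x (r / 2) y - c|.
  have sub : ball a (r / 4) `<=` ball x r.
    move=> y; rewrite !ballEmdist /= => ay.
    have := metric_triangle x a y; lra.
  (* B(x,r) lies in B(a,2r), reached from B(a,r/4) by three doublings. *)
  have dbl3 : (mu (ball x r) <= (Cd ^+ 3)%:E * mu (ball a (r / 4)))%E.
    apply: le_trans (doubling_iter _ _ dbl r40); rewrite r8.
    apply: le_outer_measure => y; rewrite !ballEmdist /= => xy.
    have := metric_triangle a x y; rewrite (metric_sym a x); lra.
  have := value_le_of_emean_le (k := expR (C1 * (4^-1 / N))) r40 sub dbl3 mf
    (fun=> expR_ge0 _) (expR_ge0 _) _ hexp.
  have -> : (C1 <= 4 * (C2 * Cd ^+ 3) * N) = (C1 * (4^-1 / N) <= C2 * Cd ^+ 3).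
    rewrite -invfM ler_pdivrMr ?mulr_gt0//; congr (_ <= _); ring.
  move=> h; apply: le_trans (h _); last first.
    move=> y /kf ky; rewrite ler_expR ler_wpM2l ?(ltW C10)//.
    by rewrite ler_wpM2r// invr_ge0 ltW.
  by apply: le_trans (expR_ge1Dx _); rewrite lerDr.
(* The small ball around x witnesses the oscillation when c is at most 1/4,
   the one around z otherwise. *)
have [c4|c4] := leP c 4^-1.
  exists x; split; first by rewrite mdistxx; lra.
  move=> y; rewrite ballEmdist /= => xy; rewrite ler_normr; apply/orP; left.
  have := @tent_half _ _ x (r / 2) y; have -> : r / 2 / 2 = r / 4 by field.
  move=> /(_ (divr_gt0 r0 (ltr0Sn _ _)) (ltW xy)); lra.
exists z; split; first by rewrite xz.
move=> y; rewrite ballEmdist /= => zy.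
have -> : tent x (r / 2) y = 0.
  apply: tent_out; first by rewrite divr_gt0.
  have := metric_triangle x y z; rewrite (metric_sym y z); lra.
by rewrite sub0r normrN ler_normr ltW.
Qed.

End metric_measure.

(** * The lower bound on the measure *)

Lemma powR_mul_le_of_root {R : realType} (c s v q : R) :
  0 < q -> 0 <= c -> 0 <= s -> 0 <= v ->
  c * s <= v `^ q^-1 -> c `^ q * s `^ q <= v.
Proof.
move=> q0 c0 s0 v0 h; rewrite -powRM//.
have -> : v = (v `^ q^-1) `^ q by rewrite -powRrM mulVf ?gt_eqF// powRr1.
by rewrite ge0_ler_powR ?nnegrE ?powR_ge0 ?mulr_ge0// ltW.
Qed.

Theorem theorem2p5 (R : realType) (Q : R) (hQ : 1 < Q) :
  (forall C1 C2 Cd : R, 0 < C1 -> 0 < C2 ->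
    exists b : R, 0 < b /\
    forall (X : pointedMetricType R) (mu : {outer_measure set X -> \bar R}),
      metric_measure_space mu -> connected [set: X] -> Q_doubling mu Q Cd ->
      (forall u : X -> R, M_space mu 1 Q%:E u -> M_norm mu 1 Q%:E u != 0%E ->
        forall (x : X) (r : R), 0 < r ->
          (emean mu (fun y => expR (C1 * (`|u y - mean mu u (ball x r)|
                                / fine (M_norm mu 1 Q%:E u))))%R (ball x r)
            <= C2%:E)%E) ->
      forall (x : X) (r : R), 0 < r ->
        (r%:E < Order.min 1%:E (diam X * (2^-1)%:E))%E ->
        ((b * r `^ Q)%:E <= mu (ball x r))%E)
  /\
  (forall p : R, Q < p -> forall C3 Cd : R, 0 < C3 ->
    exists b : R, 0 < b /\
    forall (X : pointedMetricType R) (mu : {outer_measure set X -> \bar R}),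
      metric_measure_space mu -> connected [set: X] -> Q_doubling mu Q Cd ->
      (forall u : X -> R, M_space mu 1 p%:E u ->
        exists v : X -> R, [/\ continuous v, ae_equal mu u v &
          forall y z : X, `|v y - v z| <=
            C3 * fine (M_norm mu 1 p%:E u) * mdist y z `^ (1 - Q / p)]) ->
      forall (x : X) (r : R), 0 < r ->
        (r%:E < Order.min 1%:E (diam X * (2^-1)%:E))%E ->
        ((b * r `^ Q)%:E <= mu (ball x r))%E).
Proof.
have Q0 : 0 < Q by exact: lt_trans hQ.
split.
- move=> C1 C2 Cd C10 C20.
  (* The maximum keeps b positive for every Cd; a doubling constant is at
     least 1, so it is not changed. *)
  pose D := Num.max 1 Cd; have D0 : 0 < D by rewrite lt_max ltr01.
  pose K := C2 * D ^+ 3.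
  have K0 : 0 < K by rewrite mulr_gt0// exprn_gt0.
  (* C1 <= 4 K N and N <= (2/t) mu(B(x,t))^{1/Q} with t = r/2 combine to the
     factor 16. *)
  exists ((C1 / (16 * K)) `^ Q); split.
    by rewrite powR_gt0// divr_gt0// mulr_gt0.
  move=> X mu mmu cX [dbl _] hexp x r r0.
  rewrite lt_min => /andP[r1 /(exists_far x) far].
  have r20 : 0 < r / 2 by rewrite divr_gt0.
  have r21 : r / 2 <= 1 by move: r1; rewrite lte_fin; lra.
  have [uM uN N0 Nle] := tent_norm mmu x Q0 r20 r21.
  have := hexp _ uM uN x r r0.
  move=> /(exp_oscillation_tent_le mmu cX dbl C10 N0 r0 far).
  have -> : Cd = D by case: dbl => Cd1 _; rewrite /D max_r.
  rewrite -/K; set N := fine (M_norm _ _ _ _) in Nle * => C1N.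
  apply: (@le_trans _ _ (mu (ball x (r / 2)))); last first.
    by apply: le_outer_measure; apply: le_ball; lra.
  rewrite -(fineK (mu_ball_fin mmu x (r / 2))) lee_fin.
  apply: powR_mul_le_of_root; rewrite ?(ltW r0) ?fine_ge0 ?outer_measure_ge0//.
    by rewrite ltW// divr_gt0// mulr_gt0.
  set V := fine _ `^ _ in Nle *.
  rewrite mulrAC ler_pdivrMr ?mulr_gt0//.
  have : C1 <= 4 * K * (2 / (r / 2) * V).
    by rewrite (le_trans C1N)// ler_wpM2l// mulr_ge0// ltW.
  have -> : 4 * K * (2 / (r / 2) * V) = V * (16 * K) / r.
    by field; rewrite gt_eqF.
  by rewrite ler_pdivlMr.
- move=> p Qp C3 Cd C30; have p0 : 0 < p by exact: lt_trans Qp.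
  exists ((2 * C3)^-1 `^ p); split.
    by rewrite powR_gt0// invr_gt0 mulr_gt0.
  move=> X mu mmu cX _ hol x r r0.
  rewrite lt_min => /andP[r1 /(exists_far x) [w xw]].
  have [uM _ _ Nle] := tent_norm mmu x p0 r0 (ltW r1).
  have [v [cv uv holv]] := hol _ uM.
  have [z xz] := connected_sphere cX (ltW r0) (ltW xw).
  have vE : tent x r = v.
    by apply: (continuous_ae_equal mmu) => //; exact: continuous_tent.
  have := holv x z; rewrite -vE tent_center tent_out ?xz// subr0 normr1.
  set N := fine (M_norm _ _ _ _) in Nle * => holN.
  rewrite -(fineK (mu_ball_fin mmu x r)) lee_fin.
  have -> : r `^ Q = (r `^ (Q / p)) `^ p by rewrite -powRrM divfK// gt_eqF.
  apply: powR_mul_le_of_root; rewrite ?powR_ge0 ?fine_ge0 ?outer_measure_ge0//.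
    by rewrite invr_ge0 mulr_ge0// ltW.
  set V := fine _ `^ _ in Nle *; have ra0 : 0 < r `^ (Q / p) by exact: powR_gt0.
  move: holN; rewrite powRD; last by rewrite (gt_eqF r0) implybT.
  rewrite powRN powRr1 ?(ltW r0)// mulrA ler_pdivlMr// mul1r => h.
  rewrite mulrC ler_pdivrMr ?mulr_gt0// (le_trans h)//.
  have -> : V * (2 * C3) = C3 * (2 / r * V) * r by field; rewrite gt_eqF.
  by rewrite ler_wpM2r ?(ltW r0)// ler_wpM2l// ltW.
Qed.
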